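(* Let $n\ge 1$, $i\in\{1,\dots,n\}$, $B>0$, and let $r_j>0$ for $j\neq i$ and $s_i>0$ be fixed real numbers; put $R_{-i}=\sum_{j\ne i} r_j$ and assume $B<s_i+R_{-i}$. Then requesting $r_i=s_i$ minimizes faculty member $i$'s out-of-pocket expense under the new reimbursement method: for every request $r_i>0$ with $B<r_i+R_{-i}$, $$s_i-g_i\big((s_i,\mathbf r_{-i}),s_i\big)\;\le\; s_i-g_i\big((r_i,\mathbf r_{-i}),s_i\big).$$
   Context: There are $n$ faculty members. Faculty member $j$ requests a positive amount $r_j$, $\mathbf r=(r_1,\dots,r_n)$, $R=r_1+\cdots+r_n$ is the total requested, and $B$ is the total travel budget. Throughout, only the case $B<R$ is considered. The amount actually spent by faculty member $i$ is $s_i$. For a real number $x$, $(x,\mathbf r_{-i})=(r_1,\dots,r_{i-1},x,r_{i+1},\dots,r_n)$. Under the new method the amount reimbursed to faculty member $i$ is $$g_i(\mathbf r,s_i)=\begin{cases}(B/R)\,s_i & \text{if } s_i\le r_i,\\ (B/R)\,r_i & \text{if } s_i>r_i,\end{cases}$$ where $R$ is the sum of all entries of $\mathbf r$. The out-of-pocket expense of faculty member $i$ is $s_i-g_i(\mathbf r,s_i)$, regarded as a function of the variable $r_i$ with $s_i$ and $r_j$ ($j\ne i$) fixed. *)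

(* Defs.v *)
From mathcomp Require Import all_boot all_order all_algebra.
Set Implicit Arguments.
Unset Strict Implicit.
Unset Printing Implicit Defensive.
Import Order.TTheory GRing.Theory Num.Theory.
Local Open Scope ring_scope.

Definition total_requested (K : realFieldType) (n : nat) (r : 'I_n -> K) : K :=
  \sum_(j < n) r j.

(* The vector (x, r_{-i}); the value r i is discarded. *)
Definition with_request (K : realFieldType) (n : nat) (r : 'I_n -> K)
    (i : 'I_n) (x : K) : 'I_n -> K :=
  [eta r with i |-> x].

(* g_i(r, s), where s is the amount actually spent by member i. *)
Definition reimbursement (K : realFieldType) (n : nat) (B : K)
    (r : 'I_n -> K) (i : 'I_n) (s : K) : K :=
  if s <= r i then B / total_requested r * s else B / total_requested r * r i.

Definition out_of_pocket (K : realFieldType) (n : nat) (B : K)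
    (r : 'I_n -> K) (i : 'I_n) (s : K) : K :=
  s - reimbursement B r i s.

(* Main.v *)
(* With S the sum of the other requests, requesting x reimburses B s / (x + S)
   when x >= s, which decreases in x, and B x / (x + S) when x < s, which
   increases in x; both agree at x = s. *)
Require Import Defs.
From mathcomp Require Import all_boot all_order all_algebra.
Set Implicit Arguments.
Unset Strict Implicit.
Unset Printing Implicit Defensive.
Import Order.TTheory GRing.Theory Num.Theory.
Local Open Scope ring_scope.

(** Minimizing the expense means maximizing the reimbursement, [B * min(s, x) / (x + S)] by
    [reimbursement_with_request]. Overasking only enlarges the denominator; underasking loses by
    [share_le]. *)

Lemma total_with_request (K : realFieldType) (n : nat) (r : 'I_n -> K)
    (i : 'I_n) (x : K) :
  total_requested (with_request r i x) = x + \sum_(j < n | j != i) r j.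
Proof.
rewrite /total_requested /with_request (bigD1 i) //= eqxx; congr (_ + _).
by apply: eq_bigr => j /negPf ->.
Qed.

(** Writing both branches as one [Num.min] lets two requests be compared by a single inequality. *)
Lemma reimbursement_with_request (K : realFieldType) (n : nat) (B : K)
    (r : 'I_n -> K) (i : 'I_n) (x s : K) :
  reimbursement B (with_request r i x) i s =
  B / (x + \sum_(j < n | j != i) r j) * Num.min s x.
Proof.
rewrite /reimbursement total_with_request /with_request /= eqxx.
by case: leP.
Qed.

(** After cross-multiplication [x * y] cancels, leaving [x * S <= y * S]. *)
Lemma share_le (K : realFieldType) (S x y : K) :
  0 <= S -> 0 < x -> x <= y -> x / (x + S) <= y / (y + S).
Proof.
move=> S0 x0 xy; have y0 := lt_le_trans x0 xy.
rewrite ler_pdivrMr ?ltr_wpDr // mulrAC ler_pdivlMr ?ltr_wpDr //.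
by rewrite !mulrDr [y * x]mulrC lerD2l ler_wpM2r.
Qed.

Theorem proposition1 (K : realFieldType) (n : nat) (hn : (1 <= n)%N)
    (i : 'I_n) (B : K) (hB : 0 < B)
    (r : 'I_n -> K) (hr : forall j : 'I_n, j != i -> 0 < r j)
    (si : K) (hsi : 0 < si)
    (hBsi : B < si + \sum_(j < n | j != i) r j) :
  forall ri : K, 0 < ri -> B < ri + \sum_(j < n | j != i) r j ->
    out_of_pocket B (with_request r i si) i si
      <= out_of_pocket B (with_request r i ri) i si.
Proof.
move=> ri ri0 _; rewrite /out_of_pocket lerD2l lerN2 !reimbursement_with_request.
have S0 : 0 <= \sum_(j < n | j != i) r j.
  by apply: sumr_ge0 => j ji; apply/ltW/hr.
rewrite minxx -!mulrA ler_pM2l // ![_^-1 * _]mulrC.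
(* If [ri < si], the minimum is [ri] and monotonicity of the share applies; otherwise both
   numerators are [si] and only the denominators differ. *)
have [siri|risi] := leP si ri; last by rewrite share_le // ltW.
by rewrite ler_pM2l // lef_pV2 ?posrE ?ltr_wpDr // lerD2r.
Qed.
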